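(* Let $L$ be a number field of class number $1$ with ring of integers $\mathcal{O}_L$, and let $m$ and $n$ be positive integers. Let $\mathrm{GL}_m(\mathcal{O}_L/n\mathcal{O}_L)$ act on $(\mathcal{O}_L/n\mathcal{O}_L)^m$ (viewed as column vectors) by left matrix multiplication. Then the number of orbits of this action equals $d_L(n)$.
   Context: $d_L(n)$ denotes the number of (integral) ideals of $\mathcal{O}_L$ dividing the ideal $n\mathcal{O}_L$; it is the number field analogue of the divisor function. *)

(* Defs.v *)
From HB Require Import structures.
From mathcomp Require Import all_boot all_algebra all_field.
From mathcomp Require Import finmap all_classical.
From mathcomp Require Import ring.

Set Implicit Arguments.
Unset Strict Implicit.
Unset Printing Implicit Defensive.

Import GRing.Theory.
Local Open Scope ring_scope.
Local Open Scope classical_set_scope.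
Local Open Scope quotient_scope.

(* A number field is a [fieldExtType rat], i.e. a finite extension of Q. *)

Definition integers (L : fieldExtType rat) : {pred L} :=
  fun x => `[< integralOver (intr : int -> L) x >].

Lemma integers_subring_closed (L : fieldExtType rat) :
  subring_closed (@integers L).
Proof.
split=> [|x y|x y]; rewrite !unfold_in.
- exact/asboolP/integral1.
- by move=> /asboolP ix /asboolP iy; exact/asboolP/integral_sub.
- by move=> /asboolP ix /asboolP iy; exact/asboolP/integral_mul.
Qed.

HB.instance Definition _ (L : fieldExtType rat) :=
  GRing.isSubringClosed.Build L (@integers L) (@integers_subring_closed L).

Record ringOfIntegers (L : fieldExtType rat) :=
  RingOfIntegers { oval :> L; ovalP : oval \in @integers L }.

HB.instance Definition _ (L : fieldExtType rat) :=
  [isSub of ringOfIntegers L for @oval L].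
HB.instance Definition _ (L : fieldExtType rat) :=
  [Choice of ringOfIntegers L by <:].
HB.instance Definition _ (L : fieldExtType rat) :=
  [SubChoice_isSubComNzRing of ringOfIntegers L by <:].

Definition principal (R : comNzRingType) (a : R) : {pred R} :=
  fun x => `[< exists y, x = a * y >].

Lemma principal_zmod_closed (R : comNzRingType) (a : R) :
  zmod_closed (principal a).
Proof.
split=> [|x y]; rewrite !unfold_in; first by apply/asboolP; exists 0; rewrite mulr0.
move=> /asboolP[u ->] /asboolP[v ->].
by apply/asboolP; exists (u - v); rewrite mulrBr.
Qed.

HB.instance Definition _ (R : comNzRingType) (a : R) :=
  GRing.isZmodClosed.Build R (principal a) (principal_zmod_closed a).

(* The ring R / aR.  The library puts a ring structure on [{ideal_quot I}] only
   for proper ideals I; here a may be a unit (the case n = 1), so the structure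
   is built on the additive quotient and is that of a possibly zero ring. *)
Definition quotRing (R : comNzRingType) (a : R) := Quotient.quot (principal a).

HB.instance Definition _ (R : comNzRingType) (a : R) :=
  GRing.Zmodule.on (quotRing a).
HB.instance Definition _ (R : comNzRingType) (a : R) :=
  EqQuotient.on (quotRing a).

Section QuotRing.
Variables (R : comNzRingType) (a : R).
Local Notation Q := (quotRing a).
Implicit Types x y z : Q.

Definition quotRing_one : Q := \pi_Q 1.
Definition quotRing_mul x y : Q := \pi_Q (repr x * repr y).

Lemma quotRing_piE (u v : R) : (\pi_Q u == \pi_Q v) = (u - v \in principal a).
Proof. by rewrite Quotient.idealrBE. Qed.

Lemma quotRing_piM (u v : R) :
  quotRing_mul (\pi_Q u) (\pi_Q v) = \pi_Q (u * v).
Proof.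
have reprB w : exists t, repr (\pi_Q w) = w + a * t.
  have : repr (\pi_Q w) - w \in principal a by rewrite -quotRing_piE reprK.
  rewrite unfold_in => /asboolP[t e]; exists t.
  by rewrite -e addrCA subrr addr0.
apply/eqP; rewrite quotRing_piE unfold_in; apply/asboolP.
have [s ->] := reprB u; have [t ->] := reprB v.
exists (s * v + u * t + a * s * t).
by ring.
Qed.

Lemma quotRing_piD (u v : R) : \pi_Q (u + v) = \pi_Q u + \pi_Q v :> Q.
Proof. exact: Quotient.pi_add. Qed.

Lemma quotRing_mulA : associative quotRing_mul.
Proof.
elim/quotW=> u; elim/quotW=> v; elim/quotW=> w.
by rewrite (quotRing_piM v w) (quotRing_piM u v) !quotRing_piM mulrA.
Qed.

Lemma quotRing_mulC : commutative quotRing_mul.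
Proof. by move=> x y; rewrite /quotRing_mul mulrC. Qed.

Lemma quotRing_mul1 : left_id quotRing_one quotRing_mul.
Proof. by elim/quotW=> u; rewrite quotRing_piM mul1r. Qed.

Lemma quotRing_mulDl : left_distributive quotRing_mul +%R.
Proof.
elim/quotW=> u; elim/quotW=> v; elim/quotW=> w.
by rewrite -quotRing_piD !quotRing_piM mulrDl quotRing_piD.
Qed.

HB.instance Definition _ := GRing.Zmodule_isComPzRing.Build Q
  quotRing_mulA quotRing_mulC quotRing_mul1 quotRing_mulDl.

End QuotRing.

Definition isIdeal (R : comNzRingType) (I : set R) : Prop :=
  [/\ I 0, forall x y, I x -> I y -> I (x + y)
    & forall a x, I x -> I (a * x)].

Definition idealMul (R : comNzRingType) (I J : set R) : set R :=
  [set z | exists (k : nat) (x y : 'I_k -> R),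
     [/\ forall i, I (x i), forall i, J (y i) & z = \sum_(i < k) x i * y i]].

Definition idealDvd (R : comNzRingType) (I J : set R) : Prop :=
  exists2 K : set R, isIdeal K & J = idealMul I K.

Definition idealDivisors (R : comNzRingType) (J : set R) : set (set R) :=
  [set I | isIdeal I /\ idealDvd I J].

Definition principalSet (R : comNzRingType) (a : R) : set R :=
  [set` principal a].

(* The cardinality of an infinite set is 0 under [#|` fset_set _|]. *)
Definition numIdealDivisors (L : fieldExtType rat) (n : nat) : nat :=
  #|` fset_set (idealDivisors (principalSet (n%:R : ringOfIntegers L)))|.

Definition isFractionalIdeal (L : fieldExtType rat) (I : set L) : Prop :=
  [/\ I 0 /\ (exists2 x, I x & x != 0),
      forall x y, I x -> I y -> I (x + y),
      forall (a : ringOfIntegers L) x, I x -> I (oval a * x)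
    & exists2 d : ringOfIntegers L, d != 0 &
        forall x, I x -> oval d * x \in @integers L].

(* The coset of I modulo the principal fractional ideals. *)
Definition idealClass (L : fieldExtType rat) (I : set L) : set (set L) :=
  [set J | exists2 x : L, x != 0 & J = [set x * y | y in I]].

Definition idealClasses (L : fieldExtType rat) : set (set (set L)) :=
  [set idealClass I | I in @isFractionalIdeal L].

Definition classNumber (L : fieldExtType rat) : nat :=
  #|` fset_set (@idealClasses L)|.

(* [unitmx] is only available over nonzero rings. *)
Definition GLset (R : comPzRingType) (m : nat) : set 'M[R]_m :=
  [set A | exists2 B : 'M[R]_m, A *m B = 1%:M & B *m A = 1%:M].

Definition GLorbit (R : comPzRingType) (m : nat) (v : 'cV[R]_m) :
    set 'cV[R]_m :=
  [set A *m v | A in @GLset R m].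

Definition GLorbits (R : comPzRingType) (m : nat) : set (set 'cV[R]_m) :=
  range (@GLorbit R m).

(* Main.v *)
(* Class number 1 makes the ring of integers O a principal ideal domain.  To a
   column v over O / nO attach the ideal of O generated by n and by lifts of the
   entries of v.  It is a divisor (d) of (n), is invariant under GL_m, and
   equals (d) on (d, 0, ..., 0) when d divides n.  Conversely v can be moved to
   some (a, 0, ..., 0) by Bezout 2 x 2 matrices, and (a, n) = (d) forces a and d
   to differ by a unit modulo n, so the ideal determines the orbit.  Finiteness
   of the set of divisors, which the count presupposes, follows by induction on
   a prime factorization of n. *)
Require Import Defs.
From mathcomp Require Import all_boot all_algebra all_field.
From mathcomp Require Import finmap all_classical.
From mathcomp Require Import ring.

Set Implicit Arguments.
Unset Strict Implicit.
Unset Printing Implicit Defensive.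

Import GRing.Theory.
Local Open Scope ring_scope.
Local Open Scope classical_set_scope.
Local Open Scope card_scope.
Local Open Scope quotient_scope.

(** * Divisibility, primes and comaximality in a principal ideal domain *)

Section Divisibility.
Variable R : comNzRingType.
Implicit Types a b c x y : R.

Lemma principalP a x : reflect (exists y, x = a * y) (x \in principal a).
Proof. by rewrite unfold_in; exact: asboolP. Qed.

Lemma principal_mulr a x y : x \in principal a -> x * y \in principal a.
Proof. by case/principalP=> z ->; apply/principalP; exists (z * y); rewrite mulrA. Qed.

Lemma principal_mull a x y : x \in principal a -> y * x \in principal a.
Proof. by rewrite mulrC; exact: principal_mulr. Qed.

Lemma principal_id a : a \in principal a.
Proof. by apply/principalP; exists 1; rewrite mulr1. Qed.

Lemma principal_trans b a x :
  b \in principal a -> x \in principal b -> x \in principal a.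
Proof. by move=> ab /principalP[y ->]; exact: principal_mulr. Qed.

Lemma principal_ideal a : isIdeal (principalSet a).
Proof.
rewrite /principalSet; split=> [|x y|b x] /=; rewrite ?rpred0 //; first exact: rpredD.
exact: principal_mull.
Qed.

Lemma ideal_principal_sub (I : set R) a :
  isIdeal I -> I a -> principalSet a `<=` I.
Proof. by case=> _ _ IM Ia _ /principalP[y ->]; rewrite mulrC; exact: IM. Qed.

Definition comaximal a b := exists x y, a * x + b * y = 1.

Lemma comaximalMr a b c :
  comaximal a b -> comaximal a c -> comaximal a (b * c).
Proof.
move=> [x [y e]] [z [t f]]; exists (x * (a * z + c * t) + b * y * z), (y * t).
by rewrite -[RHS](mulr1 1) -{1}e -f; ring.
Qed.

Lemma comaximalDl a b c : comaximal a b -> comaximal (a + c * b) b.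
Proof. by move=> [x [y e]]; exists x, (y - c * x); rewrite -e; ring. Qed.

Definition primeElt p :=
  [/\ p != 0, 1 \notin principal p &
    forall x y, x * y \in principal p -> x \in principal p \/ y \in principal p].

Lemma comaximal_prime p a b :
  primeElt p -> comaximal a b -> a \in principal p -> b \notin principal p.
Proof.
move=> [_ p1 _] [x [y e]] pa; apply: contra p1 => pb.
by rewrite -e; apply: rpredD; exact: principal_mulr.
Qed.

Hypothesis domR : GRing.integral_domain_axiom R.

Lemma domain_mulfI a x y : a != 0 -> a * x = a * y -> x = y.
Proof.
move=> a0 e; apply/eqP; rewrite -subr_eq0.
have /domR : a * (x - y) = 0 by rewrite mulrBr e subrr.
by rewrite (negPf a0).
Qed.

Hypothesis pidR : forall I : set R, isIdeal I -> exists a, I = principalSet a.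

(** Dividing [a] and [b] by a generator [g] of the ideal (a, b) leaves comaximal cofactors. *)
Lemma pid_bezout a b : exists g a' b' x y,
  [/\ a = g * a', b = g * b' & a' * x + b' * y = 1].
Proof.
pose I := [set z | exists x y, z = a * x + b * y].
have [|g Ig] := pidR (I := I).
  split=> [|x y [x1 [x2 ->]] [y1 [y2 ->]]|c x [x1 [x2 ->]]] /=.
  - by exists 0, 0; ring.
  - by exists (x1 + y1), (x2 + y2); ring.
  - by exists (c * x1), (c * x2); ring.
have /principalP[a' ea] : principalSet g a by rewrite -Ig; exists 1, 0; ring.
have /principalP[b' eb] : principalSet g b by rewrite -Ig; exists 0, 1; ring.
have [x [y eg]] : I g by rewrite Ig; exact: principal_id.
(* If [g] is 0, nothing can be cancelled; but then [a] and [b] vanish, and the cofactors 1 and 1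
   serve. *)
have [g0|g0] := eqVneq g 0.
  by exists 0, 1, 1, 1, 0; split; [rewrite ea g0; ring|rewrite eb g0; ring|ring].
exists g, a', b', x, y; split=> //; apply: (domain_mulfI g0).
by rewrite [RHS]mulr1 [RHS]eg ea eb; ring.
Qed.

(** Induction over proper divisors. A counterexample would start, by dependent choice, a strictly
    ascending chain of principal ideals; their union is principal, and its generator already lies in
    one term, where the chain must stop. *)
Lemma pid_noetherian_ind (P : R -> Prop) :
  (forall a, (forall b, a \in principal b -> b \notin principal a -> P b) ->
     P a) ->
  forall a, P a.
Proof.
move=> IH a; apply: contrapT => nPa.
pose T := {x : R | ~ P x}.
pose r (x y : T) := (sval x \in principal (sval y)) /\
                    (sval y \notin principal (sval x)).
have next (x : T) : {y | r x y}.
  apply: cid; case: x => x nPx; apply: contrapT => h; apply: (nPx); apply: IH => b xb bx.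
  by apply: contrapT => nPb; apply: h; exists (exist _ b nPb).
have [f [_ fr]] := dependent_choice next (exist _ a nPa).
have mono i j : (i <= j)%N -> sval (f i) \in principal (sval (f j)).
  elim: j => [|j IHj]; first by rewrite leqn0 => /eqP->; exact: principal_id.
  rewrite leq_eqVlt ltnS => /orP[/eqP->|/IHj]; first exact: principal_id.
  exact/principal_trans/(proj1 (fr j)).
have [|c Ic] := pidR (I := [set x | exists i, x \in principal (sval (f i))]).
  split=> [|x y [i xi] [j yj]|b x [i xi]] /=.
  - by exists 0%N; exact: rpred0.
  - exists (maxn i j); apply: rpredD.
      exact: principal_trans (mono _ _ (leq_maxl i j)) xi.
    exact: principal_trans (mono _ _ (leq_maxr i j)) yj.
  - by exists i; exact: principal_mull.
have [k ck] : [set x | exists i, x \in principal (sval (f i))] c.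
  by rewrite Ic; exact: principal_id.
have : principalSet c (sval (f k.+1)) by rewrite -Ic; exists k.+1; exact: principal_id.
by move/(principal_trans ck); rewrite (negPf (proj2 (fr k))).
Qed.

(** If [a] has a proper divisor that is not a unit, induction applies to that divisor; otherwise [a]
    is irreducible, hence prime by Bezout. *)
Lemma pid_prime_divisor a : a != 0 -> 1 \notin principal a ->
  exists2 p, primeElt p & a \in principal p.
Proof.
elim/pid_noetherian_ind: a => a IH a0 a1.
have [[b [ab ba b1]]|irr] := pselect (exists b,
    [/\ a \in principal b, b \notin principal a & 1 \notin principal b]).
  have b0 : b != 0 by apply: contraNneq ba => ->; exact: rpred0.
  have [p pp pb] := IH b ab ba b0 b1.
  by exists p => //; exact: principal_trans ab.
exists a; last exact: principal_id.
split=> // x y axy; have [ax|ax] := boolP (x \in principal a); first by left.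
right; have [g [a' [x' [u [v [ea ex e1]]]]]] := pid_bezout a x.
have ag : a \in principal g by apply/principalP; exists a'.
have g1 : 1 \in principal g.
  apply: contrapT => /negP g1; apply: irr; exists g; split=> //.
  apply: contra ax => ga; apply: principal_trans ga _.
  by apply/principalP; exists x'.
have [w e2] := principalP _ _ g1.
(* From a' u + x' v = 1 and g w = 1 follows (a u + x v) w = 1. Multiplied by [y], both terms on the
   left are divisible by [a]. *)
have -> : y = a * (u * w * y) + x * y * (v * w).
  rewrite [in RHS]ea [in RHS]ex -{1}[y]mul1r -{1}[1]mulr1 -{1}e1 e2; ring.
by rewrite rpredD //; apply: principal_mulr => //; exact: principal_id.
Qed.

(** Removing a prime factor leaves a proper divisor because a prime is not a unit. *)
Lemma pid_factor_ind (P : R -> Prop) :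
  (forall u, 1 \in principal u -> P u) ->
  (forall p b, primeElt p -> b != 0 -> P b -> P (p * b)) ->
  forall a, a != 0 -> P a.
Proof.
move=> Pu Pp; elim/pid_noetherian_ind=> a IH a0.
have [a1|a1] := boolP (1 \in principal a); first exact: Pu.
have [p pp /principalP[b ea]] := pid_prime_divisor a0 a1.
have b0 : b != 0 by apply: contraNneq a0 => b0; rewrite ea b0 mulr0.
rewrite ea; apply: Pp => //; apply: IH => //.
  by rewrite ea; apply: principal_mull; exact: principal_id.
case: pp => _ p1 _; apply: contra p1 => /principalP[c eb].
apply/principalP; exists c; apply: (domain_mulfI b0).
by rewrite mulr1 {1}eb ea; ring.
Qed.

(** Since p = g p', the prime [p] divides [g] or [p']. The first would make it divide [a]; the
    second makes [g] a unit, so the Bezout relation scales to 1. *)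
Lemma pid_prime_comaximal p a :
  primeElt p -> a \notin principal p -> comaximal a p.
Proof.
move=> [p0 p1 pp] pa; have [g [a' [p' [x [y [ea ep e1]]]]]] := pid_bezout a p.
have [|/principalP[c ec]|/principalP[c ec]] := pp g p'.
- by rewrite -ep; exact: principal_id.
- by move: pa; rewrite ea ec principal_mulr // principal_mulr ?principal_id.
have e2 : 1 = g * c.
  by apply: (domain_mulfI p0); rewrite mulr1 {1}ep ec; ring.
exists (x * c), (y * c); rewrite {1}ea {1}ep -[RHS]mulr1 -{1}e1 e2; ring.
Qed.

(* If the prime p divides both n = p * b and the current value t + k * s, then
   p divides neither s nor b, so adding b * s moves the value off p while
   keeping it comaximal with b. *)
Lemma pid_comaximal_shift n t s : n != 0 -> comaximal t s ->
  exists k, comaximal (t + k * s) n.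
Proof.
move=> + cts; elim/pid_factor_ind=> {n} [u /principalP[v uv]|p b pp b0 [k ck]].
  by exists 0, 0, v; rewrite uv; ring.
have [pt|pt] := boolP (t + k * s \in principal p); last first.
  by exists k; rewrite [p * b]mulrC; apply: comaximalMr => //; exact: pid_prime_comaximal.
exists (k + b).
have -> : t + (k + b) * s = (t + k * s) + s * b by ring.
rewrite [p * b]mulrC; apply: comaximalMr; first exact: comaximalDl.
apply: pid_prime_comaximal => //.
rewrite rpredDl //; apply/negP; case: (pp) => _ _ prm /prm[].
  have : comaximal (t + k * s) s by exact: comaximalDl.
  by move=> /(comaximal_prime pp) /(_ pt) /negP.
by move: ck => /(comaximal_prime pp) /(_ pt) /negP.
Qed.

(** If d e = p b, then [p] divides [d] or [e]: either d / p divides [b], or [d] itself does. Each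
    prime factor thus at most doubles the set. *)
Lemma pid_finite_divisors n : n != 0 ->
  finite_set [set principalSet d | d in [set d : R | n \in principal d]].
Proof.
elim/pid_factor_ind=> {n} [u u1|p b [p0 p1 prm] b0 fin].
  apply: sub_finite_set (finite_set1 [set: R]) => _ [d /= ud <-].
  apply/seteqP; split=> // x _; rewrite /principalSet /= -[x]mul1r.
  exact/principal_mulr/(principal_trans ud).
set D := (X in finite_set X) in fin.
have fin2 : finite_set (D `|` [set [set p * x | x in I] | I in D]).
  by rewrite finite_setU; split=> //; exact: finite_image.
apply: sub_finite_set fin2 => _ [d /= /principalP[e pbe] <-].
have [|/principalP[d' ed]|/principalP[e' ee]] := prm d e.
- by rewrite -pbe principal_mulr // principal_id.
- right; exists (principalSet d').
    exists d' => //=; apply/principalP; exists e; apply: (domain_mulfI p0).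
    by rewrite pbe ed mulrA.
  rewrite ed; apply/seteqP; split=> [_ [_ /principalP[y ->] <-]|_ /principalP[y ->]].
    by apply/principalP; exists y; rewrite mulrA.
  by exists (d' * y); [apply/principalP; exists y|rewrite mulrA].
- left; exists d => //=; apply/principalP; exists e'; apply: (domain_mulfI p0).
  by rewrite pbe ee; ring.
Qed.

End Divisibility.

(** * Orbits of the general linear group and the ideal of entries *)

Section Orbits.
Variables (S : comPzRingType) (m : nat).
Implicit Types (A B : 'M[S]_m) (v w : 'cV[S]_m).

Lemma GLset1 : @GLset S m 1%:M.
Proof. by exists 1%:M; rewrite mulmx1. Qed.

Lemma GLsetM A B : @GLset S m A -> @GLset S m B -> @GLset S m (A *m B).
Proof.
move=> [A' AA' A'A] [B' BB' B'B]; exists (B' *m A').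
  by rewrite mulmxA -(mulmxA A) BB' mulmx1.
by rewrite mulmxA -(mulmxA B') A'A mulmx1.
Qed.

Lemma GLset_scalar (a b : S) : a * b = 1 -> @GLset S m a%:M.
Proof. by move=> e; exists b%:M; rewrite -scalar_mxM ?e // mulrC e. Qed.

Lemma GLorbit_eq A v : @GLset S m A -> GLorbit (A *m v) = GLorbit v.
Proof.
move=> GA; have [A' AA' A'A] := GA.
apply/seteqP; split=> _ [B GB <-].
  by exists (B *m A); [exact: GLsetM|rewrite mulmxA].
exists (B *m A'); first by apply: GLsetM => //; exists A.
by rewrite mulmxA -(mulmxA B) A'A mulmx1.
Qed.

Lemma GLorbit_refl v : GLorbit v v.
Proof. by exists 1%:M; [exact: GLset1|rewrite mul1mx]. Qed.

(** The ideal generated by the entries of [v], written with row vectors so that u (A v) = (u A) v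
    yields invariance. *)
Definition entryIdeal v : set S :=
  [set r | exists u : 'rV[S]_m, u *m v = r%:M].

Lemma entryIdeal_sub A v : entryIdeal (A *m v) `<=` entryIdeal v.
Proof. by move=> r [u e]; exists (u *m A); rewrite -mulmxA. Qed.

Lemma entryIdeal_orbit v w : GLorbit v w -> entryIdeal w = entryIdeal v.
Proof.
move=> [A [B _ BA] <-]; apply/seteqP; split; first exact: entryIdeal_sub.
by rewrite -{1}[v]mul1mx -BA -mulmxA; exact: entryIdeal_sub.
Qed.

Lemma entryIdeal0 v : entryIdeal v 0.
Proof. by exists 0; rewrite mul0mx raddf0. Qed.

Lemma entryIdealD v a b : entryIdeal v a -> entryIdeal v b -> entryIdeal v (a + b).
Proof. by move=> [x ex] [y ey]; exists (x + y); rewrite mulmxDl ex ey raddfD. Qed.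

Lemma entryIdealM v a b : entryIdeal v b -> entryIdeal v (a * b).
Proof. by move=> [x ex]; exists (a *: x); rewrite -scalemxAl ex scale_scalar_mx. Qed.

End Orbits.

(** * Columns with a single nonzero entry, and reduction to them *)

Lemma entryIdeal_col (S : comPzRingType) m (d : S) :
  entryIdeal (col_mx d%:M 0 : 'cV_(1 + m)) = [set r | exists x, r = d * x].
Proof.
apply/seteqP; split=> [r [u]|_ [x ->]].
  rewrite -[u]hsubmxK mul_row_col mulmx0 addr0 [lsubmx u]mx11_scalar -scalar_mxM.
  move/matrixP/(_ 0 0); rewrite !mxE !mulr1n => <-.
  by exists (lsubmx u 0 0); rewrite mulrC mxE.
exists (row_mx x%:M 0); by rewrite mul_row_col mulmx0 addr0 -scalar_mxM mulrC.
Qed.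

(* A pair (g a', g b') with a' x + b' y = 1 is moved to (g, 0) by the matrix
   (x, y; -b', a'), whose determinant is 1. *)
Lemma hermite_orbit (S : comPzRingType)
    (hermite : forall a b : S, exists g a' b' x y,
      [/\ a = g * a', b = g * b' & a' * x + b' * y = 1])
    m (v : 'cV[S]_(1 + m)) :
  exists d : S, GLorbit v (col_mx d%:M 0).
Proof.
elim: m v => [|m IH] v.
  exists (v 0 0); suff <- : v = col_mx (v 0 0)%:M 0 by exact: GLorbit_refl.
  by rewrite -[LHS]vsubmxK [usubmx v]mx11_scalar [dsubmx v]flatmx0 !mxE lshift0.
have [b [A [B AB BA] Av]] := IH (dsubmx v).
have [g [a' [b' [x [y [ea eb e1]]]]]] := hermite (usubmx v 0 0) b.
exists g.
(* [M1] reduces the tail of [v] to (b, 0, ..., 0) by induction; [M2] then applies the Bezout matrix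
   to the first two entries. *)
pose M1 : 'M[S]_(1 + (1 + m)) := block_mx 1%:M 0 0 A.
pose N1 : 'M[S]_(1 + (1 + m)) := block_mx 1%:M 0 0 B.
pose P : 'M[S]_(1 + 1) := block_mx x%:M y%:M (- b')%:M a'%:M.
pose Q : 'M[S]_(1 + 1) := block_mx a'%:M (- y)%:M b'%:M x%:M.
pose M2 : 'M[S]_(1 + 1 + m) := block_mx P 0 0 1%:M.
pose N2 : 'M[S]_(1 + 1 + m) := block_mx Q 0 0 1%:M.
have PQ : P *m Q = 1%:M.
  rewrite mulmx_block -!scalar_mxM -!raddfD /= [RHS]scalar_mx_block.
  by congr (block_mx _%:M _ _ _%:M); rewrite -?e1; [ring| | |ring];
     rewrite -[RHS](raddf0 (@scalar_mx S 1)); congr _%:M; ring.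
have QP : Q *m P = 1%:M.
  rewrite mulmx_block -!scalar_mxM -!raddfD /= [RHS]scalar_mx_block.
  by congr (block_mx _%:M _ _ _%:M); rewrite -?e1; [ring| | |ring];
     rewrite -[RHS](raddf0 (@scalar_mx S 1)); congr _%:M; ring.
have G1 : @GLset S (1 + (1 + m)) M1.
  by exists N1; rewrite mulmx_block !(mulmx0, mul0mx, mulmx1, addr0, add0r);
     rewrite ?AB ?BA -scalar_mx_block.
have G2 : @GLset S (1 + 1 + m) M2.
  by exists N2; rewrite mulmx_block !(mulmx0, mul0mx, mulmx1, addr0, add0r);
     rewrite ?PQ ?QP -scalar_mx_block.
exists ((M2 : 'M_(1 + (1 + m))) *m M1); first exact: GLsetM.
rewrite -mulmxA -[v in M1 *m v]vsubmxK mul_block_col !mul0mx mul1mx addr0 add0r Av.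
rewrite [usubmx v]mx11_scalar ea eb.
(* The sizes 1 + (1 + m) and 1 + 1 + m are convertible, so regrouping the blocks needs no cast. *)
have shift (c : 'M[S]_1) (d : 'M[S]_1) :
    col_mx c (col_mx d 0) = col_mx (col_mx c d) 0 :> 'cV[S]_(1 + 1 + m).
  by rewrite [LHS]col_mxA castmx_id.
rewrite shift [M2 *m _]mul_block_col !mul0mx mulmx0 !addr0.
rewrite mul_block_col -!scalar_mxM -!raddfD /=.
have -> : x * (g * a') + y * (g * b') = g by rewrite -[RHS]mulr1 -e1; ring.
have -> : - b' * (g * a') + a' * (g * b') = 0 by ring.
by rewrite raddf0 -shift col_mx0.
Qed.

(** * Ideal divisors of a principal ideal *)

Section IdealDivisors.
Variable R : comNzRingType.
Implicit Types I J K : set R.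

Lemma idealMul_subl I K : isIdeal I -> idealMul I K `<=` I.
Proof.
move=> [I0 ID IM] _ [k [x [y [Ix _ ->]]]].
by elim/big_ind: _ => // i _; rewrite mulrC; exact: IM.
Qed.

Lemma idealMul_principal a b :
  idealMul (principalSet a) (principalSet b) = principalSet (a * b) :> set R.
Proof.
apply/seteqP; split=> [_ [k [x [y [ax by_ ->]]]]|_ /principalP[c ->]].
  apply: rpred_sum => i _.
  have /principalP[u ->] := ax i; have /principalP[w ->] := by_ i.
  by apply/principalP; exists (u * w); ring.
exists 1%N, (fun=> a), (fun=> b * c); split=> [_|_|].
- exact: principal_id.
- by apply/principalP; exists c.
- by rewrite big_ord1 mulrA.
Qed.

Hypothesis pidR : forall I, isIdeal I -> exists a, I = principalSet a.

(** To divide is to contain: (n) = I K lies in I = (d), and conversely n = d s gives (n) =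
    (d)(s). *)
Lemma pid_idealDivisorsE n :
  idealDivisors (principalSet n) =
  [set principalSet d | d in [set d : R | n \in principal d]].
Proof.
apply/seteqP; split=> [I [idI [K _ e]]|_ [d /= nd <-]].
  have [d Id] := pidR idI; exists d => //=.
  have : idealMul I K n by rewrite -e; exact: principal_id.
  by move/(idealMul_subl idI); rewrite Id.
split; first exact: principal_ideal.
have /principalP[s ->] := nd.
exists (principalSet s); first exact: principal_ideal.
by rewrite idealMul_principal.
Qed.

End IdealDivisors.

(** * Orbits modulo [n] and divisors of [n] *)

Section QuotientOrbits.
Variables (R : comNzRingType) (n : R).
Hypothesis domR : GRing.integral_domain_axiom R.
Hypothesis pidR : forall I : set R, isIdeal I -> exists a, I = principalSet a.
Hypothesis n0 : n != 0.
Local Notation Q := (quotRing n).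

Lemma quot_piM (u v : R) : \pi_Q (u * v) = \pi_Q u * \pi_Q v.
Proof. by rewrite -quotRing_piM. Qed.

Lemma quot_pi_eq (u v : R) : u - v \in principal n -> \pi_Q u = \pi_Q v.
Proof. by rewrite -quotRing_piE => /eqP. Qed.

(** The relation is found for lifts in [R], where cancellation holds, and then reduced modulo [n];
    the quotient may have zero divisors. *)
Lemma quot_hermite (a b : Q) : exists g a' b' x y,
  [/\ a = g * a', b = g * b' & a' * x + b' * y = 1].
Proof.
elim/quotW: a => a; elim/quotW: b => b.
have [g [a' [b' [x [y [-> -> e]]]]]] := pid_bezout domR pidR a b.
exists (\pi g), (\pi a'), (\pi b'), (\pi x), (\pi y).
by split; rewrite -?quot_piM // -quotRing_piD e.
Qed.

(** The preimage in [R] of the ideal of entries: it is generated by [n] and lifts of the entries. *)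
Definition contentIdeal m (v : 'cV[Q]_m) : set R :=
  [set r | entryIdeal v (\pi_Q r)].

Lemma contentIdeal_ideal m (v : 'cV[Q]_m) : isIdeal (contentIdeal v).
Proof.
split=> [|x y vx vy|a x vx]; rewrite /contentIdeal /=.
- suff -> : \pi_Q 0 = 0 :> Q by exact: entryIdeal0.
  by apply/(addrI (\pi_Q 0 : Q)); rewrite -quotRing_piD !addr0.
- by rewrite quotRing_piD; exact: entryIdealD.
- by rewrite quot_piM; exact: entryIdealM.
Qed.

Lemma contentIdeal_modulus m (v : 'cV[Q]_m) : contentIdeal v n.
Proof.
have [I0 _ _] := contentIdeal_ideal v.
rewrite /contentIdeal /= (@quot_pi_eq n 0) //.
by rewrite subr0; exact: principal_id.
Qed.

Lemma contentIdeal_col m (d : R) r :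
  contentIdeal (col_mx (\pi_Q d)%:M 0 : 'cV[Q]_(1 + m)) r <->
  exists x y, r = d * x + n * y.
Proof.
rewrite /contentIdeal /= entryIdeal_col /=; split=> [[x]|[x [y ->]]].
  elim/quotW: x => x; rewrite -quot_piM => /eqP.
  rewrite quotRing_piE => /principalP[y e].
  by exists x, y; rewrite -e; ring.
exists (\pi x); rewrite -quot_piM; apply: quot_pi_eq.
by apply/principalP; exists y; ring.
Qed.

(* With v in the orbit of (a, 0, ..., 0) and (a, n) = (d), write a = d t and
   n = d s; t and s are comaximal, so some u = t + k s is a unit modulo n, and
   a = d u modulo n. *)
Lemma GLorbit_content m (v : 'cV[Q]_(1 + m)) d :
  contentIdeal v = principalSet d -> GLorbit v = GLorbit (col_mx (\pi_Q d)%:M 0).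
Proof.
move=> vd; have [c vc] := hermite_orbit quot_hermite v.
have orb_eq (w : 'cV[Q]_(1 + m)) : GLorbit v w -> GLorbit v = GLorbit w.
  by move=> [A GA <-]; rewrite GLorbit_eq.
rewrite (orb_eq _ vc); elim/quotW: c vc => a va.
have aI r : r \in principal d <-> exists x y, r = a * x + n * y.
  rewrite -(contentIdeal_col m) /contentIdeal (entryIdeal_orbit va).
  by rewrite -[X in X <-> _]/(principalSet d r) -vd.
have /principalP[t at_] : a \in principal d.
  by apply/aI; exists 1, 0; ring.
have /principalP[s ns] : n \in principal d.
  by apply/aI; exists 0, 1; ring.
have [x [y dE]] := (aI d).1 (principal_id d).
(* [d] divides the nonzero [n], so it can be cancelled from d = a x + n y, leaving t x + s y = 1. *)
have d0 : d != 0 by apply: contraNneq n0 => d0; rewrite ns d0 mul0r.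
have cts : comaximal t s.
  exists x, y; apply: (domain_mulfI domR d0).
  by rewrite mulr1 [RHS]dE at_ ns; ring.
have [k [z [w e]]] := pid_comaximal_shift domR pidR n0 cts.
pose u := t + k * s.
have GU : @GLset Q (1 + m) (\pi_Q u)%:M.
  apply: (@GLset_scalar _ _ _ (\pi_Q z)); rewrite -quot_piM.
  rewrite -[RHS]/(\pi_Q 1); apply: quot_pi_eq; rewrite -e.
  by apply/principalP; exists (- w); rewrite /u; ring.
(* The scalar [u] carries (d, 0, ..., 0) to (u d, 0, ..., 0), and u d - a = k s d = k n. *)
rewrite -[RHS](GLorbit_eq _ GU) mul_scalar_mx scale_col_mx scaler0.
rewrite scale_scalar_mx -quot_piM (@quot_pi_eq (u * d) a) //.
by apply/principalP; exists k; rewrite /u at_ ns; ring.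
Qed.

(** The content ideal gives the bijection: its generator determines the orbit, and a divisor [d] is
    attained at (d, 0, ..., 0), which requires m > 0. *)
Lemma card_GLorbits_quot m : (0 < m)%N ->
  @GLorbits Q m #= idealDivisors (principalSet n).
Proof.
case: m => // m _.
(* Taking the union of the contents over an orbit avoids choosing a representative; all these
   contents agree. *)
pose C (X : set 'cV[Q]_(1 + m)) : set R :=
  [set r | exists2 v, X v & contentIdeal v r].
have CE (v : 'cV[Q]_(1 + m)) : C (GLorbit v) = contentIdeal v.
  apply/seteqP; split=> [r [w vw]|r vr].
    by rewrite /contentIdeal (entryIdeal_orbit vw).
  by exists v => //; exact: GLorbit_refl.
suff -> : idealDivisors (principalSet n) = C @` @GLorbits Q (1 + m).
  rewrite card_eq_sym; apply: inj_card_eq => _ _ /set_mem[v _ <-] /set_mem[w _ <-].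
  rewrite !CE => vw; have [d vd] := pidR (contentIdeal_ideal v).
  by rewrite (GLorbit_content vd); rewrite vw in vd; rewrite (GLorbit_content vd).
rewrite pid_idealDivisorsE //; apply/seteqP; split=> [_ [d /= nd <-]|].
  exists (GLorbit (col_mx (\pi_Q d)%:M 0 : 'cV[Q]_(1 + m))).
    by exists (col_mx (\pi_Q d)%:M 0).
  rewrite CE; apply/seteqP; split=> r.
    move=> /contentIdeal_col[x [y ->]].
    by apply: rpredD; apply: principal_mulr => //; exact: principal_id.
  by case/principalP=> x ->; apply/contentIdeal_col; exists x, 0; ring.
move=> _ [_ [v _ <-] <-]; rewrite CE.
have [d vd] := pidR (contentIdeal_ideal v); exists d => //=.
by have := contentIdeal_modulus v; rewrite vd.
Qed.

End QuotientOrbits.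

(** * Class number one and principal ideals of the ring of integers *)

Section RingOfIntegers.
Variable L : fieldExtType rat.
Local Notation O := (ringOfIntegers L).

Lemma ringOfIntegers_domain : GRing.integral_domain_axiom O.
Proof.
move=> x y /(congr1 val); rewrite rmorphM rmorph0 => /eqP.
by rewrite mulf_eq0 !(inj_eq val_inj _ 0).
Qed.

Lemma ringOfIntegers_natr_neq0 n : (0 < n)%N -> n%:R != 0 :> O.
Proof.
move=> n0; apply/eqP => /(congr1 val) /eqP.
rewrite rmorph_nat rmorph0 -scaler_nat scaler_eq0 oner_eq0 orbF.
by rewrite Num.Theory.pnatr_eq0 -leqn0 leqNgt n0.
Qed.

Lemma fractionalIdeal_of_ideal (I : set O) a : isIdeal I -> I a -> a != 0 ->
  isFractionalIdeal [set oval x | x in I].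
Proof.
move=> [I0 ID IM] Ia a0; split.
- split; first by exists 0.
  by exists (oval a); [exists a|apply: contraNneq a0 => e; apply/eqP/val_inj].
- by move=> _ _ [x Ix <-] [y Iy <-]; exists (x + y) => //; exact: ID.
- by move=> b _ [x Ix <-]; exists (b * x) => //; exact: IM.
- exists 1; first exact: oner_neq0.
  by move=> _ [x Ix <-]; rewrite mul1r; exact: ovalP.
Qed.

Lemma idealClass_refl (I : set L) : idealClass I I.
Proof.
exists 1; first exact: oner_neq0.
by apply/seteqP; split=> [x Ix|_ [x Ix <-]]; [exists x; rewrite ?mul1r|rewrite mul1r].
Qed.

Lemma classNumber1_eq (I J : set L) : classNumber L = 1%N ->
  isFractionalIdeal I -> isFractionalIdeal J -> idealClass I = idealClass J.
Proof.
rewrite /classNumber => /eqP /cardfs1P[c e] fI fJ.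
have fin : finite_set (idealClasses (L := L)).
  (* An infinite set of classes would be counted as 0, not 1. *)
  apply: contrapT => h; move/fsetP/(_ c): e.
  by rewrite /fset_set; case: pselect => // _; rewrite in_fset0 in_fset1 eqxx.
have in1 K : isFractionalIdeal K -> idealClass K = c.
  move=> fK; have : idealClasses (L := L) (idealClass K) by exists K.
  by rewrite -[X in X _](fset_setK fin) e /= in_fset1 => /eqP.
by rewrite (in1 I) // (in1 J).
Qed.

(** A nonzero ideal I is a fractional ideal in the class of the whole ring O, so I = x O for some
    [x] in [L]. The zero ideal is treated apart. *)
Lemma classNumber1_pid : classNumber L = 1%N ->
  forall I : set O, isIdeal I -> exists a, I = principalSet a.
Proof.
move=> hL I idI; have [I0 _ _] := idI.
have [[a Ia a0]|noa] := pselect (exists2 a, I a & a != 0); last first.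
  exists 0; apply/seteqP; split=> [x Ix|_ /principalP[y ->]]; last by rewrite mul0r.
  have [->|x0] := eqVneq x 0; first exact: rpred0.
  by case: noa; exists x.
have fI := fractionalIdeal_of_ideal idI Ia a0.
have idT : isIdeal [set: O] by [].
have fT := fractionalIdeal_of_ideal idT (Logic.I : [set: O] 1) (oner_neq0 _).
have := idealClass_refl [set oval x | x in I].
rewrite (classNumber1_eq hL fI fT) => -[x x0 Ix].
(* As x = x * 1 lies in the image of [I], the generator is itself integral. *)
have [b Ib bx] : [set oval x | x in I] x.
  by rewrite Ix; exists 1; [exists 1|rewrite mulr1].
exists b; apply/seteqP; split=> [y Iy|]; last exact: ideal_principal_sub.
have : [set oval x | x in I] (oval y) by exists y.
rewrite Ix => -[_ [z _ <-] e]; apply/principalP; exists z; apply: val_inj.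
by rewrite /= -e -bx.
Qed.

End RingOfIntegers.

Theorem theorem1p2 (L : fieldExtType rat) (hL : classNumber L = 1%N)
    (m n : nat) (hm : (0 < m)%N) (hn : (0 < n)%N) :
  @GLorbits (quotRing (n%:R : ringOfIntegers L)) m
    #= `I_(numIdealDivisors L n).
Proof.
have domO := @ringOfIntegers_domain L.
have pidO := classNumber1_pid hL.
have n0 := ringOfIntegers_natr_neq0 L hn.
apply: card_eq_trans (card_GLorbits_quot domO pidO n0 hm) _.
rewrite /numIdealDivisors; set D := idealDivisors _.
(* Finiteness ensures that the natural number counting the divisors is their true cardinality. *)
have fD : finite_set D.
  by rewrite /D pid_idealDivisorsE //; exact: pid_finite_divisors.
by rewrite -[X in X #= _](fset_setK fD); apply/card_eq_fsetP.
Qed.
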